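(* Algorithm 1 (Ultrametric Tree Construction, described in the context) requires $\mathcal{O}(n^2)$ floating-point operations to encode an essentially ultrametric matrix $A\in\mathbb{R}^{n\times n}$ as its associated tree structure. That is, there is an absolute constant $C$ such that for every $n\ge 1$ and every essentially ultrametric $A\in\mathbb{R}^{n\times n}$, the algorithm run on $A$ uses at most $Cn^2$ floating-point operations to produce the tree $(V,E)$ together with the index sets $I(u)$ and the values $f(u)$, $u\in V$.
   Context: A nonnegative (entrywise) symmetric matrix $A=[a_{ij}]\in\mathbb{R}^{n\times n}$ is called essentially ultrametric if $a_{ij}\ge\min\{a_{ik},a_{kj}\}$ for all $i,j,k$ with $i\neq j\neq k\neq i$ (pairwise distinct indices). No condition relates the diagonal entries to the off-diagonal entries. Algorithm 1 (Ultrametric Tree Construction). Input: an essentially ultrametric matrix $A=[a_{ij}]\in\mathbb{R}^{n\times n}$. Output: a directed graph $(V,E)$ (the tree associated with $A$), each vertex $u\in V$ carrying an index set $I(u)$ and a value $f(u)$. Initialize $V\gets\{r\}$, $E\gets\emptyset$, $I(r)\gets\{1,\ldots,n\}$, and call TreeRecursion($r$). The procedure TreeRecursion($u$) does the following. Set $i\gets\min I(u)$. - If $|I(u)|=1$: set $f(u)\gets a_{ii}$ and return. - Otherwise: set $f(u)\gets\min\{a_{ij}: j\in I(u)\setminus\{i\}\}$; create two new vertices $v,w$ and set $V\gets V\cup\{v,w\}$, $E\gets E\cup\{(u,v),(u,w)\}$; set $I(v)\gets\{j\in I(u): a_{ij}>f(u)\}\cup\{i\}$ and $I(w)\gets\{j\in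 I(u)\setminus\{i\}: a_{ij}=f(u)\}$; call TreeRecursion($v$), then TreeRecursion($w$). Cost convention: floating-point operations are elementary arithmetic operations on, and comparisons between, real numbers (here, comparisons involving matrix entries when computing $f(u)$, $I(v)$ and $I(w)$, each of these three being computed by one scan through $I(u)$). *)

(* Defs.v *)
From mathcomp Require Import all_boot all_order all_algebra.
From mathcomp Require Import reals.

Set Implicit Arguments.
Unset Strict Implicit.
Unset Printing Implicit Defensive.

Import Order.TTheory GRing.Theory Num.Theory.
Local Open Scope ring_scope.

(* The off-diagonal inequality is required for pairwise distinct indices only,
   so it does not constrain the diagonal entries. *)
Definition essentially_ultrametric (R : realType) (n : nat) (A : 'M[R]_n) :
    Prop :=
  [/\ forall i j, 0 <= A i j,
      A^T = A
    & forall i j k, i != j -> j != k -> k != i ->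
        Num.min (A i k) (A k j) <= A i j].

(* The memory of the algorithm: the directed graph (V, E) on vertices named by
   natural numbers, with the labels I(u) and f(u); None means "not assigned". *)
Record state (R : realType) (n : nat) := State {
  vertices : seq nat;
  edges : seq (nat * nat);
  indices : nat -> option {set 'I_n};
  value : nat -> option R }.

(* Stateful computations that count floating-point operations. A run returns
   the number of operations performed, the final memory and a result; None
   stands for a run that is stuck or has not finished. Only flop_lt and flop_eq
   below increment the counter, and the algorithm inspects real numbers only
   through these two. *)
Definition comp (R : realType) (n : nat) (T : Type) : Type :=
  state R n -> option (nat * state R n * T).

Section Primitives.
Context {R : realType} {n : nat}.
Local Notation comp := (comp R n).

Definition ret {T : Type} (x : T) : comp T := fun s => Some (0%N, s, x).

Definition stuck {T : Type} : comp T := fun=> None.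

Definition bind {T U : Type} (m : comp T) (k : T -> comp U) : comp U :=
  fun s =>
    if m s is Some (t1, s1, x) then
      if k x s1 is Some (t2, s2, y) then Some ((t1 + t2)%N, s2, y) else None
    else None.

Definition of_option {T : Type} (o : option T) : comp T :=
  if o is Some x then ret x else stuck.

Definition flop_lt (x y : R) : comp bool := fun s => Some (1%N, s, x < y).

Definition flop_eq (x y : R) : comp bool := fun s => Some (1%N, s, x == y).

Definition get_indices (u : nat) : comp {set 'I_n} :=
  fun s => of_option (indices s u) s.

Definition set_indices (u : nat) (J : {set 'I_n}) : comp unit :=
  fun s => Some (0%N,
    State (vertices s) (edges s)
      (fun x => if x == u then Some J else indices s x) (value s), tt).

Definition set_value (u : nat) (a : R) : comp unit :=
  fun s => Some (0%N,
    State (vertices s) (edges s) (indices s)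
      (fun x => if x == u then Some a else value s x), tt).

(* Adds two new vertices v, w and the edges (u, v), (u, w). *)
Definition new_children (u : nat) : comp (nat * nat) :=
  fun s =>
    let v := (\max_(x <- vertices s) x).+1 in
    let w := v.+1 in
    Some (0%N,
      State (vertices s ++ [:: v; w]) (edges s ++ [:: (u, v); (u, w)])
        (indices s) (value s), (v, w)).

End Primitives.

Notation "'let*' x := m 'in' k" := (bind m (fun x => k))
  (at level 200, x name, m at level 100, k at level 200).
Notation "m ;; k" := (bind m (fun _ : unit => k))
  (at level 100, k at level 200, right associativity).

Section Algorithm.
Context {R : realType} {n : nat}.
Local Notation comp := (comp R n).

(* Integer comparisons between indices are not floating-point operations. *)
Definition min_index (J : {set 'I_n}) : comp 'I_n :=
  of_option [pick i in J | [forall j in J, (i <= j)%N]].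

Fixpoint min_from (x : R) (l : seq R) : comp R :=
  if l is y :: l' then
    let* b := flop_lt y x in min_from (if b then y else x) l'
  else ret x.

Definition min_scan (l : seq R) : comp R :=
  if l is x :: l' then min_from x l' else stuck.

Fixpoint filter_list (p : 'I_n -> comp bool) (l : seq 'I_n) :
    comp (seq 'I_n) :=
  if l is j :: l' then
    let* b := p j in
    let* r := filter_list p l' in
    ret (if b then j :: r else r)
  else ret [::].

Definition filter_scan (p : 'I_n -> comp bool) (J : {set 'I_n}) :
    comp {set 'I_n} :=
  let* r := filter_list p (enum J) in ret [set j in r].

(* The recursion is not structural: fuel bounds its depth, and a run whose
   depth exceeds it has no result. *)
Fixpoint TreeRecursion (A : 'M[R]_n) (fuel : nat) (u : nat) : comp unit :=
  if fuel is fuel'.+1 then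
    let* Iu := get_indices u in
    let* i := min_index Iu in
    if #|Iu| == 1%N then set_value u (A i i)
    else
      let* fu := min_scan [seq A i j | j <- enum (Iu :\ i)] in
      set_value u fu;;
      let* vw := new_children u in
      let* Iv := filter_scan (fun j => flop_lt fu (A i j)) Iu in
      set_indices vw.1 (i |: Iv);;
      let* Iw := filter_scan (fun j => flop_eq (A i j) fu) (Iu :\ i) in
      set_indices vw.2 Iw;;
      TreeRecursion A fuel' vw.1;;
      TreeRecursion A fuel' vw.2
  else stuck.

Definition root : nat := 0%N.

Definition initial_state : state R n :=
  State [:: root] [::] (fun u => if u == root then Some [set: 'I_n] else None)
    (fun=> None).

(* The run on A terminates with output T after exactly t floating-point
   operations. T and t are unique, since the result must be the same for all
   sufficiently large fuel. *)
Definition tree_construction (A : 'M[R]_n) (T : state R n) (t : nat) : Prop :=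
  exists N : nat, forall fuel : nat, (N <= fuel)%N ->
    TreeRecursion A fuel root initial_state = Some (t, T, tt).

End Algorithm.

(* Main.v *)
Require Import Defs.
From mathcomp Require Import all_boot all_order all_algebra.
From mathcomp Require Import reals.
From mathcomp Require Import zify.

(** The three scans at a vertex u with m = |I(u)| >= 2 cost m - 2, m and m - 1
    operations: the minimum over m - 1 entries takes m - 2 comparisons, I(v) is
    filtered out of all of I(u), and I(w) out of I(u) without its least index i.
    So u itself costs 3 (m - 1), and a leaf costs nothing.

    As f(u) is a lower bound of the a_ij with j in I(u) \ {i}, every such j
    satisfies a_ij > f(u) or a_ij = f(u), but not both; hence I(v) and I(w)
    partition I(u). Moreover i lies in I(v), and I(w) is nonempty because the
    minimum is attained. So m = p + q with p, q >= 1 the sizes of the children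
    ([card_children]), which gives termination, and
      m (m - 1) - p (p - 1) - q (q - 1) = 2 p q >= 2 (m - 1).
    By induction on m the subtree of u costs at most 3 m (m - 1) / 2 operations,
    so 2 n^2 bounds the whole run.

    The induction [TreeRecursion_run] must also follow the memory: the call on w
    takes place in the memory left by the call on v, so the latter has to keep
    I(w) intact. This is the frame condition in [subtree_built]: a call on u
    alters no label of an existing vertex except the value of u. *)

Set Implicit Arguments.
Unset Strict Implicit.
Unset Printing Implicit Defensive.

Import Order.TTheory.
Local Open Scope ring_scope.

Section Scans.
Context {R : realType} {n : nat}.
Implicit Types (s : state R n) (J : {set 'I_n}) (A : 'M[R]_n).

Lemma bind_run (T U : Type) (m : Defs.comp R n T) (k : T -> Defs.comp R n U)
    s s1 s2 t1 t2 x y :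
  m s = Some (t1, s1, x) -> k x s1 = Some (t2, s2, y) ->
  bind m k s = Some ((t1 + t2)%N, s2, y).
Proof. by rewrite /bind => -> ->. Qed.

Lemma min_index_run J : J != set0 ->
  exists2 i, i \in J & forall s, min_index J s = Some (0%N, s, i).
Proof.
case/set0Pn=> j jJ; rewrite /min_index; case: pickP => [i /andP[iJ _] | none].
  by exists i.
have [i iJ min_i] := arg_minnP (fun k : 'I_n => k : nat) jJ.
by have := none i; rewrite (iJ : i \in J) => /negP[]; apply/forall_inP.
Qed.

Lemma min_from_run (x : R) (l : seq R) :
  exists z, [/\ z \in x :: l, {in x :: l, forall y, z <= y}
    & forall s : state R n, min_from x l s = Some (size l, s, z)].
Proof.
elim: l x => [|y l IHl] x /=.
  by exists x; split=> // [|y]; rewrite inE // => /eqP->.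
have [z [z_in z_min z_run]] := IHl (if y < x then y else x).
exists z; split=> [|a|s].
- by move: z_in; rewrite !inE; case: ifP => _ /orP[/eqP->|->]; rewrite ?eqxx ?orbT.
- have := z_min _ (mem_head _ _).
  rewrite !inE; case: ltP => xy z_le /or3P[/eqP->|/eqP->|al] //.
  + exact: le_trans z_le (ltW xy).
  + by apply: z_min; rewrite inE al orbT.
  + exact: le_trans z_le xy.
  + by apply: z_min; rewrite inE al orbT.
- by rewrite -add1n; apply: bind_run; [by [] | exact: z_run].
Qed.

Lemma min_scan_run (l : seq R) : l != [::] ->
  exists z, [/\ z \in l, {in l, forall y, z <= y}
    & forall s : state R n, min_scan l s = Some ((size l).-1, s, z)].
Proof. by case: l => // x l _; apply: min_from_run. Qed.

Lemma filter_scan_run (p : 'I_n -> Defs.comp R n bool) (q : pred 'I_n) J s :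
  (forall j, p j s = Some (1%N, s, q j)) ->
  filter_scan p J s = Some (#|J|, s, [set j in J | q j]).
Proof.
move=> p_run; have list_run l :
    filter_list p l s = Some (size l, s, [seq j <- l | q j]).
  elim: l => //= j l IHl; rewrite -add1n -[size l]addn0.
  by apply: bind_run (p_run j) _; apply: bind_run IHl _.
rewrite /filter_scan -[#|J|]addn0 cardE.
apply: bind_run (list_run _) _; congr Some; congr (_, _, _).
by apply/setP=> j; rewrite !inE mem_filter mem_enum andbC.
Qed.

(** The index sets that the recursion gives to the two children of a vertex
    with index set [J], least index [i] and value [f]. *)
Definition left_child A J i (f : R) : {set 'I_n} :=
  i |: [set j in J | f < A i j].

Definition right_child A J i (f : R) : {set 'I_n} :=
  [set j in J :\ i | A i j == f].

(** Minimality of [f] forces each index other than [i] into exactly one child,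
    and its being attained keeps the right child from being empty. *)
Lemma card_children A J i (f : R) :
    i \in J -> f \in [seq A i j | j <- enum (J :\ i)] ->
    {in [seq A i j | j <- enum (J :\ i)], forall y, f <= y} ->
  [/\ (0 < #|left_child A J i f|)%N, (0 < #|right_child A J i f|)%N
    & (#|left_child A J i f| + #|right_child A J i f|)%N = #|J|].
Proof.
move=> iJ /mapP[k]; rewrite mem_enum => kJ f_def f_min.
split.
- by apply/card_gt0P; exists i; rewrite setU11.
- by apply/card_gt0P; exists k; rewrite inE kJ f_def eqxx.
have disj : left_child A J i f :&: right_child A J i f = set0.
  apply/setP=> j; rewrite !inE.
  by case: (j == i) => //=; case: ltgtP; rewrite ?andbF.
rewrite -cardsUI disj cards0 addn0; congr #|pred_of_set _|.
apply/setP=> j; rewrite !inE.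
have [->|ji] /= := eqVneq j i; first by rewrite iJ.
case jJ: (j \in J) => //=.
rewrite eq_sym orbC -le_eqVlt; apply: f_min; apply: map_f.
by rewrite mem_enum !inE ji.
Qed.

End Scans.

Section Recursion.
Context {R : realType} {n : nat}.
Implicit Types (s : state R n) (J : {set 'I_n}) (A : 'M[R]_n) (u v w x : nat).

Definition labelled s x : Prop := indices s x <> None /\ value s x <> None.

(** The effect of a call on [u] that turns [s] into [s']: the labels of the
    vertices of [s] survive, except for the value of [u], and everything the
    call is responsible for, namely [u] and the new vertices, gets labelled. *)
Definition subtree_built u s s' : Prop :=
  [/\ {subset vertices s <= vertices s'},
      {in vertices s, forall x, indices s' x = indices s x},
      {in vertices s, forall x, x != u -> value s' x = value s x}
    & {in vertices s', forall x, x \notin vertices s \/ x = u ->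
        labelled s' x}].

Lemma fresh_vertex s x :
  (\max_(y <- vertices s) y < x)%N -> x \notin vertices s.
Proof.
move=> lt_max; apply/negP=> xs; move: lt_max.
by rewrite ltnNge (leq_bigmax_seq x).
Qed.

(** The memory in which the two recursive calls at [u] start. *)
Definition split_vertex u v w J K (f : R) s : state R n :=
  State (vertices s ++ [:: v; w]) (edges s ++ [:: (u, v); (u, w)])
    (fun x => if x == w then Some K else if x == v then Some J
              else indices s x)
    (fun x => if x == u then Some f else value s x).

Lemma subtree_built_split u v w J K (f : R) s s' s'' :
    u \in vertices s -> indices s u <> None ->
    v \notin vertices s -> w \notin vertices s -> v != w ->
    subtree_built v (split_vertex u v w J K f s) s' ->
    subtree_built w s' s'' ->
  subtree_built u s s''.
Proof.
set s1 := split_vertex _ _ _ _ _ _ _.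
move=> us Iu vs ws vw [sub1 ind1 val1 lab1] [sub2 ind2 val2 lab2].
have in_s1 x : x \in vertices s1 = [|| x \in vertices s, x == v | x == w].
  by rewrite mem_cat !inE.
have s_s1 x : x \in vertices s -> x \in vertices s1 by rewrite in_s1 => ->.
have neq x y : x \in vertices s -> y \notin vertices s -> x != y.
  by move=> xs; apply: contraNneq => <-.
have ind x : x \in vertices s -> indices s'' x = indices s x.
  move=> xs; rewrite ind2 ?ind1 ?sub1 ?s_s1 //=.
  by rewrite (negPf (neq _ _ xs ws)) (negPf (neq _ _ xs vs)).
have val x : x \in vertices s -> value s'' x = value s1 x.
  by move=> xs; rewrite val2 ?val1 ?sub1 ?s_s1 ?neq.
split=> // [x xs|x xs xu|x x_in x_new].
- by apply/sub2/sub1/s_s1.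
- by rewrite val //= (negPf xu).
have [xs'|] := boolP (x \in vertices s'); last by move=> ?; apply: lab2; auto.
have [->|xw] := eqVneq x w.
  by apply: lab2; [apply/sub2/sub1; rewrite in_s1 eqxx !orbT | right].
have [xs|xs] := boolP (x \in vertices s).
  case: x_new => [|xu]; first by rewrite xs.
  by rewrite /labelled ind ?val // xu /= eqxx.
(* Such an x was created by the call on v, or is v itself. *)
rewrite /labelled ind2 ?val2 //; apply: lab1 => //.
have [->|xv] := eqVneq x v; [by right | left].
by rewrite in_s1 !negb_or xs xv.
Qed.

Lemma subtree_built_leaf u (a : R) s :
    u \in vertices s -> indices s u <> None ->
  subtree_built u s (State (vertices s) (edges s) (indices s)
                       (fun x => if x == u then Some a else value s x)).
Proof.
move=> us Iu; split=> // [x _ /negPf /= ->|x /= xs [|->]] //.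
  by rewrite xs.
by rewrite /labelled /= eqxx.
Qed.

(** A fuel of |J| suffices since the index sets shrink at every split.
    The bound 3 m (m - 1) / 2 rather than a multiple of m^2 makes the inductive
    step close with 2 p q >= 2 (p + q - 1) alone; it is the exact cost when
    every split removes a single index. *)
Lemma TreeRecursion_run A s u J :
    u \in vertices s -> indices s u = Some J -> J != set0 ->
  exists t s', [/\ forall fuel, (#|J| <= fuel)%N ->
                     TreeRecursion A fuel u s = Some (t, s', tt),
    subtree_built u s s' & (2 * t <= 3 * (#|J| * #|J|.-1))%N].
Proof.
have [m] := ubnP #|J|; elim: m s u J => // m IHm s u J leJm us Iu J0.
have J_gt0 : (0 < #|J|)%N by rewrite card_gt0.
have Iu0 : indices s u <> None by rewrite Iu.
have [i iJ i_run] := min_index_run (R := R) J0.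
have get_run : get_indices u s = Some (0%N, s, J) by rewrite /get_indices Iu.
have [J1|J1] := eqVneq #|J| 1%N.
  exists 0%N; eexists; split=> //.
  - case=> [|fuel]; first by rewrite J1.
    move=> _ /=; apply: (bind_run get_run (t2 := 0%N)).
    by apply: bind_run (i_run _) _; rewrite J1 eqxx.
  - exact: subtree_built_leaf.
have cardJi : #|J :\ i| = #|J|.-1 by rewrite (cardsD1 i J) iJ.
have size_l : size [seq A i j | j <- enum (J :\ i)] = #|J|.-1.
  by rewrite size_map -cardE.
have [|f [f_in f_min f_run]] :=
    @min_scan_run R n [seq A i j | j <- enum (J :\ i)].
  by rewrite -size_eq0 size_l; lia.
have [p_gt0 q_gt0 pq] := card_children iJ f_in f_min.
set Jv := left_child A J i f in p_gt0 pq; set Jw := right_child A J i f in q_gt0 pq.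
pose v := (\max_(x <- vertices s) x).+1; pose w := v.+1.
have vs : v \notin vertices s by apply: fresh_vertex.
have ws : w \notin vertices s by apply: fresh_vertex; rewrite ltnW.
have vw : v != w by rewrite neq_ltn ltnSn.
pose s1 := split_vertex u v w Jv Jw f s.
have vs1 : v \in vertices s1 by rewrite mem_cat !inE eqxx orbT.
have ws1 : w \in vertices s1 by rewrite mem_cat !inE eqxx !orbT.
have [|||tv [s2 [v_run v_built tv_le]]] := IHm s1 v Jv _ vs1.
- by lia.
- by rewrite /= (negPf vw) eqxx.
- by rewrite -card_gt0.
have [v_sub v_ind _ _] := v_built.
have [||||tw [s3 [w_run w_built tw_le]]] := IHm s2 w Jw.
- by lia.
- exact: v_sub.
- by rewrite v_ind //= eqxx.
- by rewrite -card_gt0.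
exists ((#|J|.-1).-1 + (#|J| + (#|J|.-1 + (tv + tw))))%N, s3; split.
- case=> [|fuel leJ /=]; first by rewrite leqNgt J_gt0.
  apply: (bind_run get_run (t1 := 0%N)); apply: (bind_run (i_run _) (t1 := 0%N)).
  rewrite (negPf J1) -{1}size_l.
  apply: bind_run (f_run _) _.
  apply: (@bind_run _ _ _ _ _ _ _ _ _ 0%N) => //.
  apply: (@bind_run _ _ _ _ _ _ _ _ _ 0%N) => //=.
  apply: bind_run; first by apply: filter_scan_run => j.
  apply: (@bind_run _ _ _ _ _ _ _ _ _ 0%N) => //=.
  rewrite -cardJi; apply: bind_run; first by apply: filter_scan_run => j.
  apply: (@bind_run _ _ _ _ _ _ _ _ _ 0%N) => //=.
  apply: bind_run; first by apply: v_run; lia.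
  by apply: w_run; lia.
- exact: subtree_built_split v_built w_built.
- by nia.
Qed.

End Recursion.

Theorem corollary2p5 :
  exists C : nat,
    forall (R : realType) (n : nat) (A : 'M[R]_n),
      (1 <= n)%N ->
      essentially_ultrametric A ->
      exists (T : state R n) (t : nat),
        [/\ tree_construction A T t,
            forall u : nat, u \in vertices T ->
              indices T u <> None /\ value T u <> None
          & (t <= C * n ^ 2)%N].
Proof.
exists 2%N => R n A n_gt0 _.
have [//|//||t [T [run [_ _ _ lab] t_le]]] :=
    @TreeRecursion_run R n A (initial_state (R := R)) Defs.root [set: 'I_n].
  by rewrite -card_gt0 cardsT card_ord.
exists T, t; split; first by exists #|[set: 'I_n]|.
- move=> u uT; apply: lab => //; rewrite inE.
  by have [->|] := eqVneq u Defs.root; [right | left].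
- by move: t_le; rewrite cardsT card_ord; nia.
Qed.
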